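(* Let $\mathcal X,\mathcal Y,f,L,L_0,\widehat L,q$ be as in the context, with $\widehat L>L$, and let $G_v:=L(1+D_{\mathcal Y})$. Let $\epsilon>0$ be prescribed, let $\overline N\ge \frac{4G_v}{\epsilon}$, and let $\bar x:=x^{(K+1)}$ be the output returned by the SMSA algorithm described in the context with terminal sample size $\overline N$. If $$\epsilon_K\le\frac{\epsilon}{2}\qquad\text{and}\qquad \mu_K\le\frac{\epsilon_K}{2\log(\overline N)},$$ then $\bar x$ is an $\epsilon$-approximate Clarke stationary point of the problem $\min_{x\in\mathcal X}V_{\overline N}(x)$, i.e., $$\operatorname{dist}\big(0,\ \partial_\epsilon V_{\overline N}(\bar x)+\mathcal N_{\mathcal X}(\bar x)\big)\le\epsilon .$$
   Context: $\|\cdot\|$ is the Euclidean norm (operator norm for matrices), $[N]=\{1,\ldots,N\}$. $\mathcal X\subseteq\mathbb R^n$ and $\mathcal Y\subseteq\mathbb R^m$ are nonempty, compact, convex sets. $f$ is a real-valued function, twice continuously differentiable in an open neighborhood of $\mathcal X\times\mathcal Y$, and there are constants $L,L_0>0$ such that for all $(x,y),(x',y')\in\mathcal X\times\mathcal Y$: $\|\nabla f(x,y)-\nabla f(x',y')\|\le L\|(x,y)-(x',y')\|$ and $\|\nabla^2_{xy}f(x,y)-\nabla^2_{xy}f(x',y')\|\le L_0\|(x,y)-(x',y')\|$. Moreover $L$ is chosen large enough that also $\|\nabla f(x,y)\|\le L$ on $\mathcal X\times\mathcal Y$. $\widehat L>L$ is a fixed constant, $D_{\mathcal Y}$ is the diameter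 of $\mathcal Y$, and $$q(x,y)=f(x,y)+\max_{z\in\mathcal Y}\Big(\langle\nabla_yf(x,y),z-y\rangle-\tfrac{\widehat L}{2}\|z-y\|^2\Big).$$ For sample points $y_1,\ldots,y_N\in\mathcal Y$ set $V_N(x)=\max_{i\in[N]}q(x,y_i)$ and, for $\mu>0$, $\widetilde V_N(x,\mu)=\mu\log\big(\sum_{i=1}^N\exp(q(x,y_i)/\mu)\big)$. The functions $q(\cdot,y_i)$ are differentiable in $x$ on $\mathcal X$. $\mathcal N_{\mathcal X}(x)=\{\xi:\langle\xi,x'-x\rangle\le0\ \forall x'\in\mathcal X\}$, and $\Pi_{\mathcal X}$ is Euclidean projection. $\epsilon$-approximate subdifferential: $\partial_\epsilon V_N(x)=\operatorname{co}\{\nabla_xq(x,y_i): i\in[N],\ q(x,y_i)\ge V_N(x)-\epsilon\}$, where $\operatorname{co}$ is the convex hull. SMSA algorithm. Inputs: $x^{(0)}\in\mathcal X$; $\overline N\ge2$; sample sizes $2\le N_0<N_1<\cdots<N_K=\overline N$; i.i.d. samples $y_1,\ldots,y_{\overline N}\in\mathcal Y$ from a probability distribution on $\mathcal Y$; positive nonincreasing sequences $\{\mu_k\}_{k=0}^K$, $\{\epsilon_k\}_{k=0}^K$ with $0<\mu_k\le\epsilon_k\le1$. At stage $k=0,\ldots,K$, the active samples are $y_1,\ldots,y_{N_k}$. Set $z^{(0)}=x^{(k)}$, $\alpha_k=1/L_{\mu_k}$, where $$L_\mu=D_{\mathcal Y}L_0+\Big(1+\frac{L}{\widehat L}\Big)L+\frac{2G_v^2}{\mu},$$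 and for $t=0,1,2,\ldots$ compute $z^{(t+1)}=\Pi_{\mathcal X}\big(z^{(t)}-\alpha_k\nabla_z\widetilde V_{N_k}(z^{(t)},\mu_k)\big)$; as soon as $r_k(z^{(t+1)}):=\operatorname{dist}\big(0,\nabla_z\widetilde V_{N_k}(z^{(t+1)},\mu_k)+\mathcal N_{\mathcal X}(z^{(t+1)})\big)\le\epsilon_k$, set $x^{(k+1)}=z^{(t+1)}$ and end the stage. After stage $K$ (where $N_K=\overline N$) return $x^{(K+1)}$. *)

(* Defs.v *)
From HB Require Import structures.
From mathcomp Require Import all_boot all_order all_algebra.
From mathcomp Require Import all_classical all_reals all_analysis.

Set Implicit Arguments.
Unset Strict Implicit.
Unset Printing Implicit Defensive.

Import Order.TTheory GRing.Theory Num.Theory.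
Import numFieldNormedType.Exports.

Local Open Scope classical_set_scope.
Local Open Scope ring_scope.

(* Points of R^n are row vectors 'rV[R]_n and R^n x R^m is 'rV[R]_(n + m), the
   pair (x, y) being row_mx x y.  The library norm `| v | on 'rV[R]_n is the sup
   norm; it induces the usual topology and notion of differentiability, but the
   Euclidean norm has to be defined separately. *)

Section Euclidean.
Context {R : realType}.

Definition dot n (u v : 'rV[R]_n) : R := \sum_(i < n) u 0 i * v 0 i.

Definition enorm n (v : 'rV[R]_n) : R := Num.sqrt (dot v v).

(* v *m A^T is the row-vector form of the matrix-vector product A v *)
Definition opnorm n m (A : 'M[R]_(n, m)) : R :=
  sup [set enorm (v *m A^T) | v in [set v : 'rV[R]_m | enorm v <= 1]].

Definition diam n (A : set 'rV[R]_n) : R :=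
  sup [set enorm (p.1 - p.2) | p in A `*` A].

(* Valued in \bar R so that the distance to the empty set is +oo; the
   real-valued inf of the empty set would be 0. *)
Definition set_dist n (v : 'rV[R]_n) (A : set 'rV[R]_n) : \bar R :=
  ereal_inf [set (enorm (v - a))%:E | a in A].

Definition minkowski_sum n (A B : set 'rV[R]_n) : set 'rV[R]_n :=
  [set a + b | a in A & b in B].

Definition convex_hull n (A : set 'rV[R]_n) : set 'rV[R]_n :=
  [set v | exists (k : nat) (w : 'I_k -> R) (a : 'I_k -> 'rV[R]_n),
     [/\ forall i, 0 <= w i, \sum_(i < k) w i = 1, forall i, A (a i)
       & v = \sum_(i < k) w i *: a i]].

Definition normal_cone n (X : set 'rV[R]_n) (x : 'rV[R]_n) : set 'rV[R]_n :=
  [set xi | forall x', X x' -> dot xi (x' - x) <= 0].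

(* The nearest point exists and is unique when X is nonempty, closed and
   convex; 0 is the default value outside that case. *)
Definition eproj n (X : set 'rV[R]_n) (v : 'rV[R]_n) : 'rV[R]_n :=
  xget 0 [set p | X p /\ forall x', X x' -> enorm (v - p) <= enorm (v - x')].

End Euclidean.

Section Calculus.
Context {R : realType}.

Definition grad n (g : 'rV[R]_n -> R) (p : 'rV[R]_n) : 'rV[R]_n :=
  \row_(i < n) 'D_(delta_mx 0 i) g p.

(* Since 'J acts on row vectors, entry (i, j) is d_i d_j g. *)
Definition hess n (g : 'rV[R]_n -> R) (p : 'rV[R]_n) : 'M[R]_n :=
  'J (grad g) p.

Definition C2_on n (U : set 'rV[R]_n) (g : 'rV[R]_n -> R) : Prop :=
  forall p, U p ->
    [/\ differentiable g p, differentiable (grad g) p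
      & {for p, continuous (hess g)}].

Definition grad_y n m (f : 'rV[R]_(n + m) -> R) (x : 'rV[R]_n) (y : 'rV[R]_m) :
    'rV[R]_m :=
  rsubmx (grad f (row_mx x y)).

(* Entry (i, j) is the second derivative of f in x_i and y_j. *)
Definition hess_xy n m (f : 'rV[R]_(n + m) -> R) (p : 'rV[R]_(n + m)) :
    'M[R]_(n, m) :=
  ursubmx (hess f p).

End Calculus.

Section Objective.
Context {R : realType}.

Definition qfun n m (f : 'rV[R]_(n + m) -> R) (Y : set 'rV[R]_m) (Lhat : R)
    (x : 'rV[R]_n) (y : 'rV[R]_m) : R :=
  f (row_mx x y) +
  sup [set dot (grad_y f x y) (z - y) - Lhat / 2 * enorm (z - y) ^+ 2
      | z in Y].

Variables (n m : nat) (q : 'rV[R]_n -> 'rV[R]_m -> R) (y : nat -> 'rV[R]_m).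

(* Samples are numbered from 0, so the first N of them are y 0, ..., y (N - 1).
   For 0 < N the starting value of the iterated maximum is one of its terms. *)
Definition Vmax (N : nat) (x : 'rV[R]_n) : R :=
  \big[Num.max/q x (y 0%N)]_(i < N) q x (y i).

Definition Vsmooth (N : nat) (mu : R) (x : 'rV[R]_n) : R :=
  mu * ln (\sum_(i < N) expR (q x (y i) / mu)).

Definition approx_subdiff (N : nat) (eps : R) (x : 'rV[R]_n) : set 'rV[R]_n :=
  convex_hull [set grad (fun x' => q x' (y i)) x
              | i in [set i | (i < N)%N /\ Vmax N x - eps <= q x (y i)]].

End Objective.

Section Algorithm.
Context {R : realType}.

Definition pg_iterate n (X : set 'rV[R]_n) (g : 'rV[R]_n -> R) (alpha : R)
    (z0 : 'rV[R]_n) (t : nat) : 'rV[R]_n :=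
  iter t (fun z => eproj X (z - alpha *: grad g z)) z0.

Definition residual n (X : set 'rV[R]_n) (g : 'rV[R]_n -> R) (z : 'rV[R]_n) :
    \bar R :=
  set_dist 0 (minkowski_sum [set grad g z] (normal_cone X z)).

Definition stage n (X : set 'rV[R]_n) (g : 'rV[R]_n -> R) (alpha eps : R)
    (z0 z1 : 'rV[R]_n) : Prop :=
  exists t : nat,
    [/\ z1 = pg_iterate X g alpha z0 t.+1,
        (residual X g (pg_iterate X g alpha z0 t.+1) <= eps%:E)%E
      & forall s, (s < t)%N ->
          (eps%:E < residual X g (pg_iterate X g alpha z0 s.+1))%E].

Definition smsa_output n m (X : set 'rV[R]_n) (q : 'rV[R]_n -> 'rV[R]_m -> R)
    (Lmu : R -> R) (y : nat -> 'rV[R]_m) (K : nat) (N : nat -> nat)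
    (mu eps : nat -> R) (x0 xbar : 'rV[R]_n) : Prop :=
  exists x : nat -> 'rV[R]_n,
    [/\ x 0%N = x0,
        forall k, (k <= K)%N ->
          stage X (Vsmooth q y (N k) (mu k)) (1 / Lmu (mu k)) (eps k)
            (x k) (x k.+1)
      & xbar = x K.+1].

End Algorithm.

Notation borel_rV R m := (g_sigma_algebraType (@open 'rV[R]_m)).

Section Sampling.
Context {R : realType}.

(* Only the first N members of the family ys are constrained.  Taking some of
   the A i to be setT gives the product rule for every subfamily. *)
Definition iid (d : measure_display) (Omega : measurableType d)
    (P : probability Omega R) m (nu : probability (borel_rV R m) R) (N : nat)
    (ys : nat -> {RV P >-> borel_rV R m}) : Prop :=
  (forall i (A : set (borel_rV R m)), (i < N)%N -> measurable A ->
     distribution P (ys i) A = nu A) /\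
  (forall A : nat -> set (borel_rV R m), (forall i, measurable (A i)) ->
     P (\bigcap_(i in `I_N) (ys i @^-1` A i)) =
     (\prod_(i < N) P (ys i @^-1` A i))%E).

End Sampling.

(* Main.v *)
Require Import Defs.
From HB Require Import structures.
From mathcomp Require Import all_boot all_order all_algebra.
From mathcomp Require Import all_classical all_reals all_analysis.
From mathcomp Require Import ring lra.

Set Implicit Arguments.
Unset Strict Implicit.
Unset Printing Implicit Defensive.

Import Order.TTheory GRing.Theory Num.Theory.
Import numFieldNormedType.Exports.

Local Open Scope classical_set_scope.
Local Open Scope ring_scope.

(* Only the terminal stage matters: its output [xbar] lies in [X], and the
   residual test puts [grad (Vsmooth ..) xbar] within [eps K] of minus the normal
   cone.  That gradient is the average of the gradients of the functions
   [q(., y_i)] with softmax weights; a sample that is not [epsilon]-active has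
   weight at most [exp (- epsilon / mu K) <= Nbar ^- 2], so shifting these
   weights to a maximising sample moves the average by at most
   [2 * Gv / Nbar <= epsilon / 2].

   The bound [Gv] on the gradients of [q(., y_i)] comes from Danskin's theorem:
   with [w = z* - y_i], where [z*] is the maximiser defining [q], the gradient is
   the [x]-part of [grad f + D(grad f)(0, w)].  The Hessian of [f] has to be
   transposed here, because the Lipschitz hypothesis only controls the
   derivative of [grad f] in directions along the segments of [X x Y]. *)

(** * Dot product, Euclidean norm and diameter *)

Section EuclideanNorm.
Context {R : realType}.

Lemma dotC n (u v : 'rV[R]_n) : dot u v = dot v u.
Proof. by apply: eq_bigr => i _; rewrite mulrC. Qed.

Lemma dotDl n (u v w : 'rV[R]_n) : dot (u + v) w = dot u w + dot v w.
Proof. by rewrite -big_split; apply: eq_bigr => i _; rewrite mxE mulrDl. Qed.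

Lemma dotZl n a (u v : 'rV[R]_n) : dot (a *: u) v = a * dot u v.
Proof. by rewrite mulr_sumr; apply: eq_bigr => i _; rewrite mxE mulrA. Qed.

Lemma dotNl n (u v : 'rV[R]_n) : dot (- u) v = - dot u v.
Proof. by rewrite -scaleN1r dotZl mulN1r. Qed.

Lemma dotBl n (u v w : 'rV[R]_n) : dot (u - v) w = dot u w - dot v w.
Proof. by rewrite dotDl dotNl. Qed.

Lemma dotDr n (u v w : 'rV[R]_n) : dot u (v + w) = dot u v + dot u w.
Proof. by rewrite dotC dotDl !(dotC u). Qed.

Lemma dotZr n a (u v : 'rV[R]_n) : dot u (a *: v) = a * dot u v.
Proof. by rewrite dotC dotZl dotC. Qed.

Lemma dotNr n (u v : 'rV[R]_n) : dot u (- v) = - dot u v.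
Proof. by rewrite dotC dotNl dotC. Qed.

Lemma dotr0 n (u : 'rV[R]_n) : dot u 0 = 0.
Proof. by rewrite -(scale0r 0) dotZr mul0r. Qed.

Definition dot_linearE := (dotDl, dotDr, dotNl, dotNr, dotZl, dotZr).

Lemma dot_ge0 n (u : 'rV[R]_n) : 0 <= dot u u.
Proof. by apply: sumr_ge0 => i _; rewrite -expr2 sqr_ge0. Qed.

Lemma dot_delta n (u : 'rV[R]_n) i : dot u (delta_mx 0 i) = u 0 i.
Proof.
rewrite /dot (bigD1 i)//= mxE !eqxx mulr1 big1 ?addr0// => j ji.
by rewrite mxE (negbTE ji) andbF mulr0.
Qed.

Lemma dot_row_mx n m (u u' : 'rV[R]_n) (v v' : 'rV[R]_m) :
  dot (row_mx u v) (row_mx u' v') = dot u u' + dot v v'.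
Proof.
rewrite /dot big_split_ord /=.
by congr (_ + _); apply: eq_bigr => i _; rewrite ?row_mxEl ?row_mxEr.
Qed.

Lemma sqr_enorm n (u : 'rV[R]_n) : enorm u ^+ 2 = dot u u.
Proof. by rewrite sqr_sqrtr ?dot_ge0. Qed.

Lemma enorm_ge0 n (u : 'rV[R]_n) : 0 <= enorm u.
Proof. exact: sqrtr_ge0. Qed.

Lemma ler_enorm n (u : 'rV[R]_n) (c : R) :
  0 <= c -> (enorm u <= c) = (dot u u <= c ^+ 2).
Proof. by move=> c0; rewrite -sqr_enorm ler_pXn2r ?nnegrE ?enorm_ge0. Qed.

Lemma enorm0 n : enorm (0 : 'rV[R]_n) = 0.
Proof. by rewrite /enorm /dot big1 ?sqrtr0// => i _; rewrite mxE mul0r. Qed.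

Lemma enormZ n a (u : 'rV[R]_n) : enorm (a *: u) = `|a| * enorm u.
Proof.
by rewrite /enorm dotZl dotZr mulrA -expr2 sqrtrM ?sqr_ge0// sqrtr_sqr.
Qed.

Lemma enormN n (u : 'rV[R]_n) : enorm (- u) = enorm u.
Proof. by rewrite -scaleN1r enormZ normrN1 mul1r. Qed.

(** Cauchy-Schwarz: the square of [dot v v *: u - dot u v *: v] expands to [dot v v] times the
    defect of the inequality; if [dot v v] vanishes, so does every coordinate of [v]. *)
Lemma dot_sqr_le n (u v : 'rV[R]_n) : dot u v ^+ 2 <= dot u u * dot v v.
Proof.
have [v0|v0] := eqVneq (dot v v) 0.
  suff -> : dot u v = 0 by rewrite v0 expr0n mulr0.
  apply: big1 => i _; suff -> : v 0 i = 0 by rewrite mulr0.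
  move/eqP : v0; rewrite psumr_eq0 => [|j _]; last by rewrite -expr2 sqr_ge0.
  by move=> /allP /(_ i); rewrite mem_index_enum mulf_eq0 orbb => /(_ isT)/eqP.
have vp : 0 < dot v v by rewrite lt_neqAle eq_sym v0 dot_ge0.
rewrite -subr_ge0 -(pmulr_rge0 _ vp).
have := dot_ge0 (dot v v *: u - dot u v *: v).
by rewrite !dot_linearE (dotC v u); congr (_ <= _); ring.
Qed.

Lemma dot_le_enorm n (u v : 'rV[R]_n) : dot u v <= enorm u * enorm v.
Proof.
apply: le_trans (ler_norm _) _.
rewrite -(@ler_pXn2r _ 2)// ?nnegrE ?mulr_ge0 ?enorm_ge0//.
by rewrite exprMn !sqr_enorm -normrX ger0_norm ?sqr_ge0 ?dot_sqr_le.
Qed.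

Lemma enormD n (u v : 'rV[R]_n) : enorm (u + v) <= enorm u + enorm v.
Proof.
rewrite ler_enorm ?addr_ge0 ?enorm_ge0//.
rewrite !dot_linearE (dotC v u) sqrrD !sqr_enorm.
by have := dot_le_enorm u v; lra.
Qed.

Lemma enorm_sum n (I : finType) (F : I -> 'rV[R]_n) :
  enorm (\sum_i F i) <= \sum_i enorm (F i).
Proof.
elim/big_ind2: _ => [|u a v b ua vb|//]; first by rewrite enorm0.
exact: le_trans (enormD _ _) (lerD _ _).
Qed.

Lemma enorm_lsubmx n m (u : 'rV[R]_(n + m)) : enorm (lsubmx u) <= enorm u.
Proof.
rewrite ler_enorm ?enorm_ge0// sqr_enorm -{3 4}(hsubmxK u) dot_row_mx.
by rewrite lerDl dot_ge0.
Qed.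

Lemma enorm_row_mx0 n m (v : 'rV[R]_m) :
  enorm (row_mx (0 : 'rV[R]_n) v) = enorm v.
Proof.
by rewrite /enorm dot_row_mx -(sqr_enorm 0) enorm0 expr0n add0r.
Qed.

(** The topology comes from the sup norm, so continuity is obtained from the coordinate
    functions. *)
Lemma continuous_enorm n : continuous (@enorm R n).
Proof.
have cdot : continuous (fun v : 'rV[R]_n => dot v v).
  apply: continuous_big => [|i _ v]; first exact: add_continuous.
  by apply: continuousM; exact: coord_continuous.
move=> u; apply: (@continuous_comp _ _ _ (fun v => dot v v)); first exact: cdot.
exact: sqrt_continuous.
Qed.

(** A real [sup] bounds its set only when that set is bounded; here the bound comes from the compact
    image of [A] under [enorm]. *)
Lemma compact_diam n (A : set 'rV[R]_n) u v :
  compact A -> A u -> A v -> enorm (u - v) <= diam A.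
Proof.
move=> cA Au Av; apply: ub_le_sup; last by exists (u, v).
have ecA : compact [set enorm a | a in A].
  apply: continuous_compact cA; apply: continuous_subspaceT.
  exact: continuous_enorm.
have /compact_bounded [M [_ /(_ (M + 1))]] := ecA.
rewrite ltrDl ltr01 => /(_ isT) MA.
have leM a : A a -> enorm a <= M + 1.
  by move=> Aa; apply: le_trans (ler_norm _) (MA _ _); exists a.
exists ((M + 1) + (M + 1)) => _ [[a b] [/= Aa Ab] <-].
by apply: le_trans (enormD _ _) _; rewrite enormN lerD ?leM.
Qed.

Lemma convex_set_segment n (A : set 'rV[R]_n) u v t :
  @convex_set R 'rV[R]_n A -> A u -> A v -> 0 <= t <= 1 ->
  A (u + t *: (v - u)).
Proof.
move=> cA Au Av /andP[t0 t1]; have := cA v u (Itv01 t0 t1).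
rewrite !inE => /(_ Av Au); congr A.
rewrite /conv /=. rewrite scalerBl scale1r scalerBr addrC -addrA.
by congr (_ + _); rewrite addrC.
Qed.

End EuclideanNorm.

(** * Euclidean projection onto a compact convex set *)

(** First-order optimality at [t = 0]: expanding the square gives
    [2 * t * dot a b <= t ^+ 2 * dot b b], which fails for small [t] when [dot a b] is positive. *)
Lemma dot_le0_segment (R : realType) n (a b : 'rV[R]_n) :
  (forall t, 0 <= t <= 1 -> enorm a <= enorm (a - t *: b)) -> dot a b <= 0.
Proof.
move=> amin; rewrite leNgt; apply/negP; set c := dot a b => c0.
have b0 := dot_ge0 b; set d := dot b b in b0.
have e0 : 0 < d + c + 1 by lra.
(* This choice gives [t <= 1] and [t * d < c], against [2 * c <= t * d]. *)
pose t := c / (d + c + 1).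
have t0 : 0 < t by rewrite divr_gt0.
have td : t * d < c by rewrite /t mulrAC ltr_pdivrMr// ltr_pM2l//; lra.
have t01 : 0 <= t <= 1 by rewrite ltW//= ler_pdivrMr//; lra.
have := amin _ t01.
rewrite ler_enorm ?enorm_ge0// sqr_enorm !dot_linearE (dotC b a) -/c -/d.
nra.
Qed.

Section Projection.
Context {R : realType} {n : nat}.
Variables (A : set 'rV[R]_n) (v : 'rV[R]_n).
Hypotheses (A0 : A !=set0) (cA : compact A).

(** A continuous function attains its minimum on a compact set, so [xget] does not fall back on its
    default. *)
Lemma eprojP :
  A (eproj A v) /\ forall a, A a -> enorm (v - eproj A v) <= enorm (v - a).
Proof.
have cdist : {within A, continuous (fun a => enorm (v - a))}.
  apply: continuous_subspaceT.
  have csub : continuous (fun a : 'rV[R]_n => v - a).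
    by move=> a; apply: continuousB => //; exact: cst_continuous.
  by move=> a; apply: continuous_comp; [exact: csub|exact: continuous_enorm].
have [c /[!inE] Ac cmin] := compact_EVT_min A0 cA cdist.
rewrite /eproj; apply: (@xgetPex _ _ [set p | A p /\ _]).
by exists c; split=> // a Aa; apply: cmin; rewrite inE.
Qed.

(** The obtuse-angle property: by convexity the segment from the projection to [z] stays in [A], so
    minimality can be tested along it. *)
Lemma eproj_dot_le0 z : @convex_set R 'rV[R]_n A -> A z ->
  dot (v - eproj A v) (z - eproj A v) <= 0.
Proof.
move=> convA Az; have [Ap pmin] := eprojP.
apply: dot_le0_segment => t t01; rewrite -addrA -opprD.
by apply: pmin; exact: convex_set_segment.
Qed.

End Projection.

(* Up to the factor [Lh / 2], the maximised function is a constant minus the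
   squared distance of [z] to [y + p / Lh], so the maximiser is a projection. *)
Section RegularizedSupport.
Context {R : realType} {m : nat}.
Variables (Y : set 'rV[R]_m) (y : 'rV[R]_m) (Lh : R).
Hypotheses (Y0 : Y !=set0) (cY : compact Y).
Hypotheses (convY : @convex_set R 'rV[R]_m Y) (Lh0 : 0 < Lh).

Definition reg_support (p : 'rV[R]_m) : R :=
  sup [set dot p (z - y) - Lh / 2 * enorm (z - y) ^+ 2 | z in Y].

Definition reg_argmax (p : 'rV[R]_m) : 'rV[R]_m := eproj Y (y + Lh^-1 *: p).

Lemma reg_argmax_in p : Y (reg_argmax p).
Proof. by have [] := eprojP (y + Lh^-1 *: p) Y0 cY. Qed.

(** Quadratic growth away from the maximiser, due to strong concavity. After expansion it is [Lh]
    times the obtuse-angle inequality of the projection. *)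
Lemma reg_argmax_growth p z : Y z ->
  dot p (z - y) - Lh / 2 * enorm (z - y) ^+ 2
    + Lh / 2 * enorm (z - reg_argmax p) ^+ 2 <=
  dot p (reg_argmax p - y) - Lh / 2 * enorm (reg_argmax p - y) ^+ 2.
Proof.
move=> Yz; have := eproj_dot_le0 (y + Lh^-1 *: p) Y0 cY convY Yz.
rewrite -/(reg_argmax p); set s := reg_argmax p.
have -> : z - y = (s - y) + (z - s) by rewrite [RHS]addrC subrKA.
have -> : y + Lh^-1 *: p - s = Lh^-1 *: p - (s - y).
  by rewrite opprB [RHS]addrC -!addrA; congr (_ + _); rewrite addrC.
move: (s - y) (z - s) => a b.
rewrite dotBl dotZl !sqr_enorm !dot_linearE (dotC b a) => le0.
have : Lh * (Lh^-1 * dot p b - dot a b) <= 0 by rewrite pmulr_rle0.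
by rewrite mulrBr mulVKf ?gt_eqF//; lra.
Qed.

Lemma reg_supportE p : reg_support p =
  dot p (reg_argmax p - y) - Lh / 2 * enorm (reg_argmax p - y) ^+ 2.
Proof.
set s := reg_argmax p.
have sY : [set dot p (z - y) - Lh / 2 * enorm (z - y) ^+ 2 | z in Y]
    (dot p (s - y) - Lh / 2 * enorm (s - y) ^+ 2).
  by exists s => //; exact: reg_argmax_in.
have ub : ubound [set dot p (z - y) - Lh / 2 * enorm (z - y) ^+ 2 | z in Y]
    (dot p (s - y) - Lh / 2 * enorm (s - y) ^+ 2).
  move=> _ [z Yz <-]; apply: le_trans (reg_argmax_growth _ Yz).
  by rewrite lerDl mulr_ge0 ?divr_ge0 ?sqr_ge0 ?ltW.
apply/eqP; rewrite eq_le; apply/andP; split.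
  by apply: ge_sup => //; exists (dot p (s - y) - Lh / 2 * enorm (s - y) ^+ 2).
by apply: ub_le_sup => //; eexists; exact: ub.
Qed.

(** Danskin's theorem with an explicit remainder. Each maximiser is tested in the growth inequality
    of the other: one test bounds the remainder below by zero, the other bounds it above once
    Young's inequality is applied. *)
Lemma reg_support_expansion p p' :
  `|reg_support p' - reg_support p - dot (p' - p) (reg_argmax p - y)|
    <= (2 * Lh)^-1 * enorm (p' - p) ^+ 2.
Proof.
rewrite !reg_supportE.
have := reg_argmax_growth p' (reg_argmax_in p).
have := reg_argmax_growth p (reg_argmax_in p').
move: (reg_argmax p) (reg_argmax p') => s s'.
rewrite -(enormN (s - s')) opprB.
have -> : s' - y = (s - y) + (s' - s) by rewrite [RHS]addrC subrKA.
have -> : p' = p + (p' - p) by rewrite addrC subrK.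
rewrite !(addrC p) addrK.
move: (s - y) (s' - s) (p' - p) => a b c; rewrite !sqr_enorm => up lo.
(* Young's inequality, from the square of [c - Lh *: b]; its [dot b b] term is absorbed by quadratic
   growth. *)
have amgm : dot c b <= Lh / 2 * dot b b + (2 * Lh)^-1 * dot c c.
  have i0 : 0 <= (2 * Lh)^-1 by rewrite invr_ge0 mulr_ge0// ltW.
  rewrite -subr_ge0; have := mulr_ge0 i0 (dot_ge0 (c - Lh *: b)).
  rewrite !dot_linearE (dotC b c); congr (_ <= _).
  by field; rewrite gt_eqF.
have b0 : 0 <= Lh / 2 * dot b b by rewrite mulr_ge0 ?dot_ge0 ?divr_ge0 ?ltW.
have c0 : 0 <= (2 * Lh)^-1 * dot c c.
  by rewrite mulr_ge0 ?dot_ge0 ?invr_ge0 ?mulr_ge0 ?ltW.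
move: up lo amgm b0 c0; rewrite !dot_linearE (dotC b a) => *.
rewrite ler_norml; apply/andP; split; lra.
Qed.

End RegularizedSupport.

(** * Directional derivatives and Danskin's theorem along a curve *)

Section DirectionalDerivative.
Context {R : realType}.

Lemma is_deriveP (V W : normedModType R) (f : V -> W) x v df :
  is_derive x v f df <->
  h^-1 *: (f (h *: v + x) - f x) @[h --> 0^'] --> df.
Proof.
split=> [[dfx <-]|cf]; first exact: dfx.
by split; [apply: cvgP cf|exact: cvg_lim].
Qed.

(** Turns a directional derivative into a derivative in one real variable, where the chain rule
    applies. *)
Lemma is_derive_line (V W : normedModType R) (f : V -> W) x v df :
  is_derive x v f df <-> is_derive (0 : R) 1 (fun h : R => f (h *: v + x)) df.
Proof.
rewrite !is_deriveP.
set g1 := fun h => h^-1 *: _; set g2 := fun h : R => h^-1 *: _.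
suff -> : g1 = g2 by [].
by apply/funext => h; rewrite /g1 /g2 addr0 scale0r add0r [_%:A]mulr1.
Qed.

Lemma is_derive_comp1 (V : normedModType R) (f : V -> R) (g : R -> R) x v a b :
  is_derive (f x) 1 g a -> is_derive x v f b -> is_derive x v (g \o f) (a * b).
Proof.
move=> ga /is_derive_line fb; apply/is_derive_line.
by apply: is_derive1_comp; rewrite scale0r add0r.
Qed.

Lemma continuous_dotl n (w : 'rV[R]_n) : continuous (fun u => dot u w).
Proof.
apply: continuous_big => [|i _ u]; first exact: add_continuous.
by apply: continuousM; [exact: coord_continuous|exact: cst_continuous].
Qed.

Lemma is_derive_dot (V : normedModType R) n (p : V -> 'rV[R]_n) x v dp w :
  is_derive x v p dp -> is_derive x v (fun z => dot (p z) w) (dot dp w).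
Proof.
move=> /is_deriveP pd; apply/is_deriveP.
rewrite (_ : (fun h => _) =
  (fun u => dot u w) \o (fun h : R => h^-1 *: (p (h *: v + x) - p x))).
  by apply: continuous_cvg pd; exact: continuous_dotl.
by apply/funext => h /=; rewrite dotZl dotBl.
Qed.

(** The difference quotient is squeezed: it differs from that of [dot (p z) w], with [w] frozen at
    [x], by at most the quadratic remainder divided by [h]. *)
Lemma is_derive_reg_support (V : normedModType R) m (Y : set 'rV[R]_m) y Lh
    (p : V -> 'rV[R]_m) x v dp :
  Y !=set0 -> compact Y -> @convex_set R 'rV[R]_m Y -> 0 < Lh ->
  is_derive x v p dp ->
  is_derive x v (fun z => reg_support Y y Lh (p z))
    (dot dp (reg_argmax Y y Lh (p x) - y)).
Proof.
move=> Y0 cY convY Lh0 pd; apply/is_deriveP.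
have /is_deriveP dotd := is_derive_dot (reg_argmax Y y Lh (p x) - y) pd.
move/is_deriveP : pd => pd.
set w := reg_argmax _ _ _ _ - y in dotd *.
pose Q h := h^-1 *: (p (h *: v + x) - p x).
(* The remainder divided by [h], written with the quotient [Q h]; [Q h] converges, so the factor [h]
   drives [E] to zero. *)
pose E h := `|h| * ((2 * Lh)^-1 * (enorm (Q h) * enorm (Q h))).
have eQ : enorm (Q h) @[h --> 0^'] --> enorm dp.
  by apply: continuous_cvg pd; exact: continuous_enorm.
have E0 : E h @[h --> 0^'] --> 0 * ((2 * Lh)^-1 * (enorm dp * enorm dp)).
  apply: cvgM.
    by apply/norm_cvg0P; exact: cvg_within.
  by apply: cvgM; [exact: cvg_cst|exact: cvgM].
rewrite mul0r in E0.
pose D h := h^-1 *: (dot (p (h *: v + x)) w - dot (p x) w).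
apply: (@squeeze_cvgr _ _ _ _ (fun h => D h - E h) (fun h => D h + E h)).
- near=> h.
  have h0 : h != 0 by near: h; exact: nbhs_dnbhs_neq.
  have := reg_support_expansion y Y0 cY convY Lh0 (p x) (p (h *: v + x)).
  rewrite -/w dotBl -ler_distl /D /E /Q -scalerBr [`|_ *: _|]normrM enormZ.
  rewrite normfV -(ler_pM2l (_ : 0 < `|h|^-1)) ?invr_gt0 ?normr_gt0//.
  move/le_trans; apply; rewrite le_eqVlt; apply/orP; left; apply/eqP.
  by field; rewrite normr_eq0 h0 gt_eqF.
- by have := cvgB dotd E0; rewrite subr0; apply.
- by have := cvgD dotd E0; rewrite addr0; apply.
Unshelve. all: by end_near. Qed.

End DirectionalDerivative.

(** * Symmetry of second derivatives *)

Section Clairaut.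
Context {R : realType} {V : normedModType R}.
Implicit Types (f g : V -> R) (p u v : V).

(** The mean value theorem in direction [u] turns the second difference into a first difference of
    [g], which is then linearised at [p]. *)
Lemma mixed_difference f g p u v e : 0 < e ->
  (\forall z \near p, is_derive z u f (g z)) -> differentiable g p ->
  exists2 r, 0 < r & forall h, 0 < h < r ->
    `|f (h *: u + h *: v + p) - f (h *: u + p) - f (h *: v + p) + f p
      - h ^+ 2 * 'D_v g p| <= e * h ^+ 2.
Proof.
move=> e0 fdiff gdiff.
pose M := `|u| + `|v| + 1.
have M0 : 0 < M by rewrite ltr_pwDr ?addr_ge0.
(* Every point met below is within [h * M] of [p], so each of the two linearisation errors is at
   most [e' * (h * M) = e / 2 * h]. *)
pose e' := e / (2 * M).
have e'0 : 0 < e' by rewrite divr_gt0 ?mulr_gt0.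
have grem : \forall k \near (0 : V), `|g (k + p) - g p - 'd g p k| <= e' * `|k|.
  have /eqaddoP /(_ _ e'0) := diff_locally gdiff.
  apply: filterS => k /=; rewrite opprD addrA; apply.
have fdiff0 : \forall k \near (0 : V), is_derive (k + p) u f (g (k + p)).
  move: fdiff; rewrite (near_shift 0 p) subr0; exact.
have : \forall k \near (0 : V), is_derive (k + p) u f (g (k + p)) /\
    `|g (k + p) - g p - 'd g p k| <= e' * `|k|.
  by near=> k; split; near: k.
move=> /nbhs_ballP[d /= d0 dP].
have {}dP k : `|k| < d -> is_derive (k + p) u f (g (k + p)) /\
    `|g (k + p) - g p - 'd g p k| <= e' * `|k|.
  by move=> kd; apply: dP; rewrite -ball_normE /= sub0r normrN.
exists (d / M); first exact: divr_gt0.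
move=> h /andP[h0]; rewrite ltr_pdivlMr// => hd.
have small c : 0 <= c <= h -> `|c *: u + h *: v| <= h * M /\ `|c *: u| <= h * M.
  move=> /andP[c0 ch]; rewrite (le_trans (ler_normD _ _)) !normrZ ?ger0_norm//;
    have := normr_ge0 u; have := normr_ge0 v; rewrite /M => *; nra.
(* The second difference is [phi h - phi 0]. *)
pose phi (s : R) := f (s *: u + (h *: v + p)) - f (s *: u + p).
pose dphi (s : R) := g (s *: u + (h *: v + p)) - g (s *: u + p).
have dline (s : R) b : is_derive (s *: u + b) u f (g (s *: u + b)) ->
    is_derive s 1 (fun t : R => f (t *: u + b)) (g (s *: u + b)).
  move=> /is_derive_line fd; apply/is_derive_line; move: fd.
  congr is_derive; apply/funext => t; congr f.
  by rewrite [_%:A]mulr1 scalerDl addrA.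
have phi' s : s \in `[0, h] -> is_derive s 1 phi (dphi s).
  rewrite in_itv/= => /small[su sv].
  have [d1 _] := dP _ (le_lt_trans su hd).
  have [d2 _] := dP _ (le_lt_trans sv hd).
  by apply: is_deriveB; apply: dline; rewrite ?addrA.
have der s : s \in `]0, h[%R -> is_derive s 1 phi (dphi s).
  by move=> /subset_itv_oo_cc; exact: phi'.
have cont : {within `[0, h], continuous phi}.
  by apply: derivable_within_continuous => s /phi'[].
have [c cI] := @MVT R phi dphi 0 h h0 der cont.
move: cI => /subset_itv_oo_cc.
rewrite in_itv/= => /small [c1 c2].
have [_ r1] := dP _ (le_lt_trans c1 hd).
have [_ r2] := dP _ (le_lt_trans c2 hd).
rewrite /phi /dphi subr0 !scale0r !add0r deriveE// -(addrA (h *: u)) => eq.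
have {}r1 := le_trans r1 (ler_wpM2l (ltW e'0) c1).
have {}r2 := le_trans r2 (ler_wpM2l (ltW e'0) c2).
set B : R := 'd g p v; set C : R := 'd g p (c *: u) in r2.
have dBC : 'd g p (c *: u + h *: v) = C + h * B.
  by rewrite linearD; congr (_ + _); exact: linearZ.
rewrite dBC -(addrA (c *: u)) in r1.
have eM : e' * (h * M) = e / 2 * h by rewrite /e'; field; rewrite gt_eqF.
rewrite eM in r1 r2.
(* Subtracting the linearisations at both points cancels [C] and leaves [h] times a difference of
   two remainders. *)
rewrite [X in `|X|](_ : _ = h * (g (c *: u + (h *: v + p)) - g p - (C + h * B)
    - (g (c *: u + p) - g p - C))); last first.
  by lra.
rewrite normrM gtr0_norm// expr2 mulrCA ler_pM2l//.
by rewrite (le_trans (ler_normB _ _))//; lra.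
Unshelve. all: by end_near. Qed.

(** The second difference is symmetric in [u] and [v], so for small [h] the same number approximates
    [h ^+ 2] times either mixed derivative. *)
Lemma Clairaut f gu gv p u v :
  (\forall z \near p, is_derive z u f (gu z)) -> differentiable gu p ->
  (\forall z \near p, is_derive z v f (gv z)) -> differentiable gv p ->
  'D_v gu p = 'D_u gv p.
Proof.
move=> fu ud fv vd; apply/eqP; rewrite -subr_eq0 -normr_le0.
apply/ler_addgt0Pr => e e0; rewrite add0r.
have e20 : 0 < e / 2 by rewrite divr_gt0.
have [r r0 rP] := mixed_difference v e20 fu ud.
have [s s0 sP] := mixed_difference u e20 fv vd.
pose h := Num.min r s / 2.
have m0 : 0 < Num.min r s by rewrite lt_min r0.
have h0 : 0 < h by rewrite divr_gt0.
have hm : h < Num.min r s by rewrite /h; lra.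
move: hm; rewrite lt_min => /andP[hr hs].
have /rP rh : 0 < h < r by rewrite h0.
have /sP sh : 0 < h < s by rewrite h0.
rewrite (addrC (h *: v) (h *: u)) (addrAC _ (- f (h *: v + p))) in sh.
have h2 : 0 < h ^+ 2 by rewrite exprn_gt0.
rewrite -(ler_pM2l h2) -{1}(gtr0_norm h2) -normrM mulrBr.
have close (T A B c : R) : `|T - A| <= c -> `|T - B| <= c -> `|B - A| <= c + c.
  move=> TA TB; have -> : B - A = (T - A) - (T - B) by ring.
  by rewrite (le_trans (ler_normB _ _))// lerD.
apply: le_trans (close _ _ _ _ sh rh) _.
by rewrite -mulrDl -splitr mulrC.
Qed.

End Clairaut.

(** * Gradients, the Hessian as a symmetric form, and the gradient of [qfun] *)

Section Gradient.
Context {R : realType}.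

Lemma linear_dotl n (u : 'rV[R]_n) : linear (fun w => dot w u).
Proof. by move=> a v w; rewrite dotDl dotZl. Qed.

Lemma differentiable_dotl n (u w : 'rV[R]_n) :
  differentiable (fun w => dot w u) w.
Proof.
pose dot_lin := GRing.isLinear.Build _ _ _ _ _ (linear_dotl u).
pose D : {linear 'rV[R]_n -> R} := HB.pack (fun w => dot w u) dot_lin.
by have := @linear_differentiable _ _ _ D w; apply; exact: continuous_dotl.
Qed.

Lemma is_derive_diff (V W : normedModType R) (F : V -> W) p v :
  differentiable F p -> is_derive p v F ('d F p v).
Proof.
by move=> dF; apply: DeriveDef; [exact: diff_derivable|rewrite deriveE].
Qed.

Lemma derive_grad n (g : 'rV[R]_n -> R) p v :
  differentiable g p -> is_derive p v g (dot (grad g p) v).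
Proof.
move=> dg; apply: DeriveDef; first exact: diff_derivable.
rewrite deriveE// {1}(row_sum_delta v) linear_sum; apply: eq_bigr => i _.
by rewrite linearZ mxE deriveE// mulrC.
Qed.

Lemma diff_grad_sym n (f : 'rV[R]_n -> R) p u v :
  (\forall z \near p, differentiable f z) -> differentiable (grad f) p ->
  dot ('d (grad f) p v) u = dot ('d (grad f) p u) v.
Proof.
move=> fd gd.
have near_grad w : \forall z \near p, is_derive z w f (dot (grad f z) w).
  by apply: filterS fd => z; exact: derive_grad.
have dgrad w : differentiable (fun z => dot (grad f z) w) p.
  by apply: differentiable_comp gd (differentiable_dotl _ _).
have dgradE w w' :
    'D_w (fun z => dot (grad f z) w') p = dot ('d (grad f) p w) w'.
  exact: (@derive_val _ _ _ _ _ _ _ (is_derive_dot w' (is_derive_diff w gd))).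
rewrite -!dgradE; exact: Clairaut (near_grad u) _ (near_grad v) _.
Qed.

(** The derivative is taken as a limit from the right, since the increments are controlled only at
    points of the segment leading from [p] to [p + d]. *)
Lemma enorm_diff_le n k (F : 'rV[R]_n -> 'rV[R]_k) p d C :
  differentiable F p ->
  (forall t, 0 < t < 1 -> enorm (F (t *: d + p) - F p) <= t * C) ->
  enorm ('d F p d) <= C.
Proof.
move=> dF FC.
have /is_deriveP Fd := is_derive_diff d dF.
have {}Fd : enorm (h^-1 *: (F (h *: d + p) - F p)) @[h --> 0^'+] -->
    enorm ('d F p d).
  apply: continuous_cvg; first exact: continuous_enorm.
  exact: cvg_dnbhs_at_right.
rewrite -(cvg_lim _ Fd)//; apply: limr_le; first exact: cvgP Fd.
near=> h.
have h0 : 0 < h by near: h; exact: nbhs_right_gt.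
have h1 : h < 1 by near: h; exact: nbhs_right_lt.
by rewrite enormZ gtr0_norm ?invr_gt0// ler_pdivrMl// FC// h0.
Unshelve. all: by end_near. Qed.

Variables (n m : nat) (f : 'rV[R]_(n + m) -> R) (Y : set 'rV[R]_m) (Lh : R).
Hypotheses (Y0 : Y !=set0) (cY : compact Y).
Hypotheses (convY : @convex_set R 'rV[R]_m Y) (Lh0 : 0 < Lh).
Variables (x : 'rV[R]_n) (y : 'rV[R]_m).
Let p := row_mx x y.
Hypotheses (df : \forall z \near p, differentiable f z)
  (dgf : differentiable (grad f) p).
Let w := reg_argmax Y y Lh (grad_y f x y) - y.

Lemma is_derive_row_mxl (W : normedModType R) (F : 'rV[R]_(n + m) -> W) v :
  differentiable F p ->
  is_derive x v (fun x' => F (row_mx x' y)) ('d F p (row_mx v 0)).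
Proof.
move=> dF; apply/is_derive_line.
have /is_derive_line := is_derive_diff (row_mx v 0) dF.
congr is_derive; apply/funext => h; congr F.
by rewrite scale_row_mx scaler0 add_row_mx add0r.
Qed.

(** The supremum depends on [x] only through the linear coefficient [grad_y f x y], so Danskin's
    theorem applies with [y] fixed. *)
Lemma is_derive_qfun v :
  is_derive x v (fun x' => qfun f Y Lh x' y)
    (dot (grad f p) (row_mx v 0) +
     dot ('d (grad f) p (row_mx 0 w)) (row_mx v 0)).
Proof.
have df0 : differentiable f p := nbhs_singleton df.
apply: is_deriveD.
  have [_ <-] := derive_grad (row_mx v 0) df0.
  by rewrite deriveE//; exact: is_derive_row_mxl.
have drsub : is_derive x v (fun x' => grad_y f x' y)
    (rsubmx ('d (grad f) p (row_mx v 0))).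
  have /is_deriveP := is_derive_row_mxl v dgf; rewrite is_deriveP => gd.
  rewrite (_ : (fun h => _) = rsubmx \o
    (fun h => h^-1 *: (grad f (row_mx (h *: v + x) y) - grad f p))).
    by apply: continuous_cvg gd; exact: continuous_rsubmx.
  by apply/funext => h; apply/rowP => i; rewrite !mxE.
have := is_derive_reg_support y Y0 cY convY Lh0 drsub.
(* Symmetry of the Hessian exchanges [row_mx v 0] and [row_mx 0 w]; pairing with the latter selects
   the [y]-part. *)
rewrite -/w diff_grad_sym// -{2}(hsubmxK ('d (grad f) p (row_mx v 0))).
by rewrite dot_row_mx dotr0 add0r.
Qed.

Lemma grad_qfun : grad (fun x' => qfun f Y Lh x' y) x =
  lsubmx (grad f p + 'd (grad f) p (row_mx 0 w)).
Proof.
apply/rowP => i; rewrite [LHS]mxE.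
have [_ ->] := is_derive_qfun (delta_mx 0 i).
rewrite -dotDl -[in LHS](hsubmxK (_ + _)) dot_row_mx dot_delta.
by rewrite dotr0 addr0.
Qed.

(** The term [grad f p] contributes [L]; the Hessian term contributes [L * enorm w], and [w] joins
    two points of [Y]. *)
Lemma enorm_grad_qfun L :
  enorm (grad f p) <= L -> 0 <= L ->
  (forall y', Y y' -> enorm (grad f (row_mx x y') - grad f p)
    <= L * enorm (row_mx x y' - p)) -> Y y ->
  enorm (grad (fun x' => qfun f Y Lh x' y) x) <= L * (1 + diam Y).
Proof.
move=> gL L0 lipL Yy; have Yw := reg_argmax_in y Lh Y0 cY (grad_y f x y).
rewrite grad_qfun (le_trans (enorm_lsubmx _))// (le_trans (enormD _ _))//.
rewrite mulrDr mulr1 lerD//.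
apply: le_trans (_ : L * enorm w <= _); last first.
  by rewrite ler_wpM2l// compact_diam.
apply: enorm_diff_le => // t /andP[t0 t1].
(* Only the second component moves, along a segment of [Y], so the Lipschitz bound applies at every
   such point. *)
have eqp : t *: row_mx 0 w + p = row_mx x (y + t *: w).
  by rewrite scale_row_mx scaler0 add_row_mx add0r addrC.
rewrite eqp (le_trans (lipL _ _))//.
  by apply: convex_set_segment => //; rewrite !ltW.
rewrite -eqp addrK enormZ enorm_row_mx0 gtr0_norm// mulrCA.
by [].
Qed.

End Gradient.

(** * The softmax gradient and its distance to the approximate subdifferential *)

Section Smoothing.
Context {R : realType} {n m : nat}.
Variables (q : 'rV[R]_n -> 'rV[R]_m -> R) (y : nat -> 'rV[R]_m) (N : nat).
Hypothesis N0 : (0 < N)%N.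
Implicit Types (x : 'rV[R]_n) (mu : R).

Definition softmax mu x (i : 'I_N) : R :=
  expR (q x (y i) / mu) / \sum_(j < N) expR (q x (y j) / mu).

Let sum_expR_gt0 mu x : 0 < \sum_(j < N) expR (q x (y j) / mu).
Proof.
rewrite (bigD1 (Ordinal N0))//= ltr_pwDl ?expR_gt0//.
by apply: sumr_ge0 => i _; exact: expR_ge0.
Qed.

Lemma softmax_ge0 mu x i : 0 <= softmax mu x i.
Proof. by rewrite divr_ge0 ?expR_ge0 ?(ltW (sum_expR_gt0 _ _)). Qed.

Lemma sum_softmax mu x : \sum_i softmax mu x i = 1.
Proof. by rewrite -mulr_suml divff// gt_eqF. Qed.

(** The outer factor [mu] cancels the [mu^-1] coming from the exponentials, and the derivative of
    [ln] supplies the softmax denominator. *)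
Lemma grad_Vsmooth mu x : 0 < mu ->
  (forall (i : 'I_N) v, derivable (fun z => q z (y i)) x v) ->
  grad (Vsmooth q y N mu) x =
  \sum_i softmax mu x i *: grad (fun z => q z (y i)) x.
Proof.
move=> mu0 dq; apply/rowP => k; rewrite mxE summxE; set v := delta_mx 0 k.
have dexp (t : R) :
    is_derive t 1 (fun s : R => expR (s / mu)) (expR (t / mu) * mu^-1).
  apply: (@is_derive1_comp _ expR (fun s => s / mu)).
  rewrite (_ : (fun s => s / mu) = mu^-1 *: id).
    by apply: is_derive_eq; rewrite [_ *: 1]mulr1.
  by apply/funext => s; rewrite mulrC.
have dsum : is_derive x v (fun z => \sum_(i < N) expR (q z (y i) / mu))
    (\sum_(i < N) expR (q x (y i) / mu) * mu^-1 * 'D_v (fun z => q z (y i)) x).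
  rewrite (_ : (fun z => _) = \sum_(i < N) (fun z => expR (q z (y i) / mu))).
    apply: is_derive_sum => i.
    exact: is_derive_comp1 (dexp _) (derivableP (dq i v)).
  by apply/funext => z; rewrite fct_sumE.
have dln := is_derive_comp1 (is_derive1_ln (sum_expR_gt0 mu x)) dsum.
have [_ ->] := is_deriveZ mu dln.
rewrite -[LHS]/(mu * (_ * _)) !mulr_sumr; apply: eq_bigr => i _.
rewrite !mxE -/v /softmax; field.
by rewrite !gt_eqF.
Qed.

Lemma Vmax_attained x : exists i : 'I_N, q x (y i) = Vmax q y N x.
Proof.
rewrite /Vmax; elim/big_ind: _ => [|a b [i <-] [j <-]|i _].
- by exists (Ordinal N0).
- by case: leP => _; [exists j|exists i].
- by exists i.
Qed.

(** The denominator is at least the exponential belonging to a maximising sample. *)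
Lemma softmax_le mu x eps (i : 'I_N) :
  0 < mu -> q x (y i) < Vmax q y N x - eps ->
  softmax mu x i <= expR (- (eps / mu)).
Proof.
move=> mu0 qi; have [j qj] := Vmax_attained x.
rewrite ler_pdivrMr ?sum_expR_gt0// (bigD1 j)//= mulrDr.
apply: ler_wpDr.
  by rewrite mulr_ge0 ?expR_ge0//; apply: sumr_ge0 => k _; exact: expR_ge0.
rewrite -expRD ler_expR qj addrC -mulrBl ler_pM2r ?invr_gt0//; exact: ltW.
Qed.

(** With this bound the at most [N] inactive weights add up to no more than [1 / N]. *)
Lemma softmax_le_sqr mu x eps (i : 'I_N) : 0 < mu -> 2 * ln N%:R <= eps / mu ->
  q x (y i) < Vmax q y N x - eps -> softmax mu x i <= N%:R ^- 2.
Proof.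
move=> mu0 lnN /(softmax_le mu0)/le_trans; apply.
have N0' : 0 < N%:R :> R by rewrite ltr0n.
rewrite -[N%:R in leRHS]lnK ?posrE// -expRM_natr -expRN ler_expR lerN2.
by rewrite mulrC.
Qed.

(* The weights of the samples that are not [eps]-active are moved to a
   maximiser. *)
Lemma grad_Vsmooth_near mu x eps G : 0 < mu -> 0 <= eps ->
  2 * ln N%:R <= eps / mu ->
  (forall (i : 'I_N) v, derivable (fun z => q z (y i)) x v) ->
  (forall i : 'I_N, enorm (grad (fun z => q z (y i)) x) <= G) ->
  exists2 a, approx_subdiff q y N eps x a
    & enorm (grad (Vsmooth q y N mu) x - a) <= 2 * G / N%:R.
Proof.
move=> mu0 eps0 lnN dq qG; have [k qk] := Vmax_attained x.
pose g (i : 'I_N) := grad (fun z => q z (y i)) x.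
pose active (i : 'I_N) := Vmax q y N x - eps <= q x (y i).
pose s i := if active i then i else k.
have G0 : 0 <= G := le_trans (enorm_ge0 _) (qG k).
have N0' : 0 < N%:R :> R by rewrite ltr0n.
exists (\sum_i softmax mu x i *: g (s i)).
  (* A convex combination may repeat points, so the weights stay indexed by all samples and only the
     gradients are replaced. *)
  exists N, (softmax mu x), (g \o s); split => //.
  - exact: softmax_ge0.
  - exact: sum_softmax.
  - move=> i; exists (s i : nat) => //=; split => //.
    by rewrite /s; case: ifP => // _; rewrite qk lerBlDr lerDl.
rewrite grad_Vsmooth// -sumrB (le_trans (enorm_sum _))//.
(* The bound is spread evenly over the [N] samples, so that the sums compare term by term. *)
have -> : 2 * G / N%:R = \sum_(i < N) N%:R ^- 2 * (2 * G).
  by rewrite sumr_const card_ord -mulr_natr; field; rewrite gt_eqF.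
apply: ler_sum => i _; rewrite -scalerBr enormZ ger0_norm ?softmax_ge0//.
rewrite /s; case: ifPn => [_|].
  by rewrite subrr enorm0 mulr0 !mulr_ge0// ?invr_ge0 ?exprn_ge0 ?ltW.
rewrite -ltNge => /(softmax_le_sqr mu0 lnN) si.
apply: ler_pM si _; [exact: softmax_ge0|exact: enorm_ge0|].
rewrite (le_trans (enormD _ _))// enormN mulr_natl mulr2n.
exact: lerD (qG i) (qG k).
Qed.

End Smoothing.

(** * Transfer of the residual bound and conclusion *)

(** Replacing [g] by [a] while keeping the same element of [C] changes the norm by at most [d]. *)
Lemma set_dist_minkowski_sum (R : realType) n (g a : 'rV[R]_n)
    (A C : set 'rV[R]_n) (e d : R) :
  A a -> enorm (g - a) <= d ->
  (set_dist 0 (minkowski_sum [set g] C) <= e%:E)%E ->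
  (set_dist 0 (minkowski_sum A C) <= (e + d)%:E)%E.
Proof.
move=> Aa gad ge.
(* With [d] on the left, it is enough to bound each member of the set on the right, so no nearest
   point has to be chosen. *)
suff H : (set_dist 0 (minkowski_sum A C) - d%:E <=
    set_dist 0 (minkowski_sum [set g] C))%E.
  by rewrite EFinD -leeBlDr//; exact: le_trans H ge.
apply/ereal_infP => _ [_ [_ -> [c Cc <-]] <-].
rewrite leeBlDr// -EFinD; apply: ge_ereal_inf.
exists (enorm (0 - (a + c)))%:E.
  by exists (a + c) => //; exists a => //; exists c.
rewrite lee_fin !sub0r !enormN.
have -> : a + c = g + c - (g - a).
  by rewrite opprB [g + c]addrC -addrA [g + (a - g)]addrC subrK addrC.
by rewrite (le_trans (enormD _ _))// enormN lerD2l.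
Qed.

Theorem theorem3 (R : realType) (n m : nat)
  (X : set 'rV[R]_n) (Y : set 'rV[R]_m)
  (X_nonempty : X !=set0) (X_compact : compact X)
  (X_convex : @convex_set R 'rV[R]_n X)
  (Y_nonempty : Y !=set0) (Y_compact : compact Y)
  (Y_convex : @convex_set R 'rV[R]_m Y)
  (f : 'rV[R]_(n + m) -> R) (U : set 'rV[R]_(n + m))
  (U_open : open U)
  (XY_sub_U : forall x y, X x -> Y y -> U (row_mx x y))
  (f_C2 : C2_on U f)
  (L L0 Lhat : R) (L_gt0 : 0 < L) (L0_gt0 : 0 < L0)
  (grad_lipschitz : forall x y x' y', X x -> Y y -> X x' -> Y y' ->
     enorm (grad f (row_mx x y) - grad f (row_mx x' y'))
     <= L * enorm (row_mx x y - row_mx x' y'))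
  (hess_xy_lipschitz : forall x y x' y', X x -> Y y -> X x' -> Y y' ->
     opnorm (hess_xy f (row_mx x y) - hess_xy f (row_mx x' y'))
     <= L0 * enorm (row_mx x y - row_mx x' y'))
  (grad_bounded : forall x y, X x -> Y y -> enorm (grad f (row_mx x y)) <= L)
  (L_lt_Lhat : L < Lhat)
  (d : measure_display) (Omega : measurableType d) (P : probability Omega R)
  (nu : probability (borel_rV R m) R) (nu_on_Y : nu Y = 1%E)
  (Nbar : nat) (Nbar_ge2 : (2 <= Nbar)%N)
  (ys : nat -> {RV P >-> borel_rV R m})
  (ys_iid : iid nu Nbar ys)
  (ys_in_Y : forall i omega, (i < Nbar)%N -> Y (ys i omega))
  (K : nat) (N : nat -> nat) (mu eps : nat -> R) (x0 : 'rV[R]_n)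
  (x0_in_X : X x0)
  (N0_ge2 : (2 <= N 0)%N)
  (N_increasing : forall k, (k < K)%N -> (N k < N k.+1)%N)
  (N_final : N K = Nbar)
  (mu_eps_bounds : forall k, (k <= K)%N ->
     [/\ 0 < mu k, mu k <= eps k & eps k <= 1])
  (mu_nonincreasing : forall k, (k < K)%N -> mu k.+1 <= mu k)
  (eps_nonincreasing : forall k, (k < K)%N -> eps k.+1 <= eps k)
  (epsilon : R) (epsilon_gt0 : 0 < epsilon) :
  let q := qfun f Y Lhat in
  let Gv := L * (1 + diam Y) in
  let Lmu := fun mu' : R =>
    diam Y * L0 + (1 + L / Lhat) * L + 2 * Gv ^+ 2 / mu' in
  4 * Gv / epsilon <= Nbar%:R ->
  eps K <= epsilon / 2 ->
  mu K <= eps K / (2 * ln (Nbar%:R)) ->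
  forall (omega : Omega) (xbar : 'rV[R]_n),
    let y := fun i => ys i omega : 'rV[R]_m in
    smsa_output X q Lmu y K N mu eps x0 xbar ->
    (set_dist 0 (minkowski_sum (approx_subdiff q y Nbar epsilon xbar)
                            (normal_cone X xbar)) <= epsilon%:E)%E.
Proof.
move=> q Gv Lmu NGv epsK muK omega xbar y [xs [_ stages xsK]].
have [muK0 _ _] := mu_eps_bounds K (leqnn K).
have N0 : (0 < Nbar)%N by exact: ltnW.
have NR0 : 0 < Nbar%:R :> R by rewrite ltr0n.
have [t [zt res _]] := stages K (leqnn K).
rewrite -zt -xsK N_final in res.
have Xxbar : X xbar.
  (* The stage makes [t.+1] steps, hence at least one, so its output is a projection onto [X]. *)
  by rewrite xsK zt; exact: (eprojP _ X_nonempty X_compact).1.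
have Lhat0 : 0 < Lhat := lt_trans L_gt0 L_lt_Lhat.
have Yy (i : 'I_Nbar) : Y (y i) by exact: ys_in_Y.
have near_diff (i : 'I_Nbar) :
    \forall z \near row_mx xbar (y i), differentiable f z.
  have Up := XY_sub_U _ _ Xxbar (Yy i).
  by apply: filterS (open_nbhs_nbhs (conj U_open Up)) => z /f_C2[].
have diff_grad (i : 'I_Nbar) : differentiable (grad f) (row_mx xbar (y i)).
  by have [] := f_C2 _ (XY_sub_U _ _ Xxbar (Yy i)).
have dq (i : 'I_Nbar) v : derivable (fun z => q z (y i)) xbar v.
  by have [] := is_derive_qfun Y_nonempty Y_compact Y_convex Lhat0
    (near_diff i) (diff_grad i) v.
have qG (i : 'I_Nbar) : enorm (grad (fun z => q z (y i)) xbar) <= Gv.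
  apply: enorm_grad_qfun => //; first exact: grad_bounded.
  - exact: ltW.
  - by move=> y' Yy'; exact: grad_lipschitz.
have lnN0 : 0 < ln Nbar%:R :> R by rewrite ln_gt0// ltr1n.
(* As the logarithm is positive, the bound on [mu K] gives [2 * ln Nbar%:R * mu K <= eps K], and
   [eps K <= epsilon / 2]. *)
have lnN : 2 * ln Nbar%:R <= epsilon / mu K.
  rewrite ler_pdivlMr//; move: muK; rewrite ler_pdivlMr ?mulr_gt0// => muK.
  by lra.
have [a Aa ga] := grad_Vsmooth_near N0 muK0 (ltW epsilon_gt0) lnN dq qG.
have := set_dist_minkowski_sum Aa ga res.
move/le_trans; apply; rewrite lee_fin.
(* The sample-size condition pays for one half of [epsilon]; the residual [eps K] takes the
   other. *)
have : 2 * Gv / Nbar%:R <= epsilon / 2.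
  rewrite ler_pdivrMr//; move: NGv; rewrite ler_pdivrMr//; lra.
by lra.
Qed.
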